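(* For $p\in(0,1)$ let $\Psi_p(t):=\min\{t/p,1\}$, and let $\Psi_0(t):=\mathbf{1}_{t>0}$, $t\in[0,1]$. Then $\mathrm{R}_{\Psi_p}$ $\Gamma$-converges to $\mathrm{R}_{\Psi_0}$ as $p\to0$ in the weak-* topology of $L^\infty(\mathcal{X};\sigma)$. Furthermore, the $\Gamma$-convergence also holds with respect to the weak-* topology of $L^\infty(\mathcal{X};\nu)$.
   Context: Setting: $\mathcal{X}$ is a set, $\mathcal{A}\subset 2^{\mathcal{X}}$ a $\sigma$-algebra, and $\mu$ a probability measure on $(\mathcal{X}\times\{0,1\},\mathcal{A}\otimes 2^{\{0,1\}})$. For $i\in\{0,1\}$ put $\rho_i(B):=\mu(B\times\{i\})$, and $\rho:=\rho_0+\rho_1$. $\{\mathfrak{m}_x\}_{x\in\mathcal{X}}$ is a family such that $\mathfrak{m}_x$ is a probability measure on $(\mathcal{X},\mathcal{A})$ for $\rho$-almost every $x$, and $x\mapsto\mathfrak{m}_x(B)$ is measurable for every $B\in\mathcal{A}$. Define $\sigma(B):=\int_{\mathcal{X}}\mathfrak{m}_x(B)\,d\rho(x)$ and $\nu(B):=\frac12\sigma(B)+\frac12\rho(B)$. For $A\in\mathcal{A}$: $$\mathrm{R}_\Psi(A):=\int_{\mathcal{X}}\Psi(\mathfrak{m}_x(A))\,d\rho_0(x)+\int_{\mathcal{X}}\Psi(\mathfrak{m}_x(A^c))\,d\rho_1(x).$$ For $\lambda\in\{\sigma,\nu\}$, functionals of sets $A\in\mathcal{A}$ are regarded as functionals on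 $\{\mathbf{1}_A:A\in\mathcal{A}\}\subset L^\infty(\mathcal{X};\lambda)$ with the weak-* topology (convergence of integrals against every $\varphi\in L^1(\mathcal{X};\lambda)$). $F_p$ $\Gamma$-converges to $F$ as $p\to0$ if for every sequence $p_n\to0$ in $(0,1)$: (i) whenever $\mathbf{1}_{A_n}\to\mathbf{1}_A$ one has $\liminf_n F_{p_n}(A_n)\ge F(A)$; (ii) for every $A$ there is a sequence with $\mathbf{1}_{A_n}\to\mathbf{1}_A$ and $\limsup_n F_{p_n}(A_n)\le F(A)$. *)

(* Defs.v *)
(* MathComp-Analysis. *)
From HB Require Import structures.
From mathcomp Require Import all_boot all_order all_algebra.
From mathcomp Require Import all_classical all_reals all_analysis.
From mathcomp Require Import measurable_realfun.

Set Implicit Arguments.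
Unset Strict Implicit.
Unset Printing Implicit Defensive.

Import Order.TTheory GRing.Theory Num.Theory.
Import numFieldNormedType.Exports.

Local Open Scope classical_set_scope.
Local Open Scope ring_scope.
Local Open Scope ereal_scope.

(* The labels 0 and 1 are the booleans false and true; bool carries the
   discrete sigma-algebra and X * bool the product sigma-algebra. *)
Section label_marginal.
Context {R : realType} {d : measure_display} {X : measurableType d}.
Variables (mu : probability (X * bool)%type R) (i : bool).

Definition rho_ (B : set X) : \bar R := mu (B `*` [set i]).

Let rho_0 : rho_ set0 = 0.
Proof. by rewrite /rho_ set0X measure0. Qed.

Let rho_ge0 B : 0 <= rho_ B.
Proof. exact: measure_ge0. Qed.

Let rho_sigma_additive : semi_sigma_additive rho_.
Proof.
move=> F mF tF mUF; rewrite /rho_.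
have UX : (\bigcup_n F n) `*` [set i] = \bigcup_n (F n `*` [set i]).
  apply/seteqP; split => [[x b] /= [[n _ Fx] bi]|[x b] [n _ /= [Fx bi]]].
    by exists n.
  by split => //; exists n.
rewrite UX; apply: measure_semi_sigma_additive.
- by move=> n; apply: measurableX.
- move=> j k _ _ [[x b] /= [[Fj _] [Fk _]]].
  by apply: (tF j k) => //; exists x.
- by rewrite -UX; apply: measurableX.
Qed.

HB.instance Definition _ := isMeasure.Build _ _ _ rho_
  rho_0 rho_ge0 rho_sigma_additive.

End label_marginal.

Definition rho {R : realType} {d : measure_display} {X : measurableType d}
    (mu : probability (X * bool)%type R) : {measure set X -> \bar R} :=
  measure_add (rho_ mu false) (rho_ mu true).

(* A family of set functions (m_x) that is a probability measure only for
   almost every x; nothing but measurability is asked of m_x at the other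
   points.  Library measures are functions on all sets, constrained only by
   nonnegativity off the sigma-algebra, so requiring equality on all sets is
   no restriction: a measure given on the sigma-algebra extends by 0. *)
Record aekernel {R : realType} {d : measure_display} {X : measurableType d}
    (lambda : {measure set X -> \bar R}) := AEKernel {
  aekernel_fun :> X -> set X -> \bar R ;
  aekernel_prob : {ae lambda, forall x,
    exists P : probability X R, aekernel_fun x = P :> (set X -> \bar R)} ;
  aekernel_measurable : forall B, measurable B ->
    measurable_fun setT (aekernel_fun ^~ B) }.

Section mixture.
Import HBNNSimple.
Context {R : realType} {d : measure_display} {X : measurableType d}.
Context {lambda : {measure set X -> \bar R}}.
Variable m : aekernel lambda.

Definition sigma (B : set X) : \bar R := \int[lambda]_x m x B.

Let sigma0 : sigma set0 = 0.
Proof.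
rewrite /sigma (ae_eq_integral (cst 0)) ?integral0//.
- exact: aekernel_measurable.
- apply: filterS (aekernel_prob m) => x [P mP] _.
  by rewrite mP measure0.
Qed.

(* B need not be measurable here, hence the detour by simple functions. *)
Let sigma_ge0 B : 0 <= sigma B.
Proof.
rewrite /sigma integralE.
suff -> : \int[lambda]_x (fun x => m x B)^\- x = 0.
  by rewrite sube0; apply: integral_ge0.
apply/eqP; rewrite eq_le; apply/andP; split; last exact: integral_ge0.
rewrite ge0_integralTE//; apply: ge_ereal_sup => _ [h hle <-].
rewrite -integralT_nnsfun (ae_eq_integral (cst 0)) ?integral0//.
- by apply/measurable_EFinP; exact: measurable_funPT.
- apply: filterS (aekernel_prob m) => x [P mP] _.
  apply/eqP; rewrite eq_le; apply/andP; split; last first.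
    by rewrite lee_fin; apply: fun_ge0.
  apply: le_trans (hle x) _; rewrite funenegE mP ge_max lexx andbT.
  by rewrite leeNl oppe0 measure_ge0.
Qed.

Let sigma_sigma_additive : semi_sigma_additive sigma.
Proof.
move=> F mF tF mUF.
have [N [mN N0 Nm]] := aekernel_prob m.
pose g B x := if x \in ~` N then m x B else 0.
have gP x : x \in ~` N -> exists P : probability X R,
    forall B, g B x = P B.
  move=> xN; have : (~` N) x by rewrite inE in xN.
  move=> nNx; have /contrapT[P mP] : ~ ~ exists P : probability X R,
      m x = P :> (set X -> \bar R) by move=> /Nm.
  by exists P => B; rewrite /g xN mP.
have g0 x : x \notin ~` N -> forall B, g B x = 0.
  by move=> /negbTE xN B; rewrite /g xN.
have mg B : measurable B -> measurable_fun setT (g B).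
  move=> mB; have -> : g B = (fun x => m x B) \_ (~` N) by apply/funext.
  apply/(measurable_restrictT _ _).1; first exact: measurableC.
  by apply: measurable_funS (aekernel_measurable m mB).
have g_ge0 B x : 0 <= g B x.
  have [/gP[P ->]|/g0->//] := boolP (x \in ~` N).
  exact: measure_ge0.
have sigmaE B : measurable B -> sigma B = \int[lambda]_x g B x.
  move=> mB; apply: ae_eq_integral => //; first exact: aekernel_measurable.
    exact: mg.
  exists N; split => // x /=; apply: contra_notP => nNx _.
  by rewrite /g mem_set.
rewrite (sigmaE _ mUF).
have -> : \int[lambda]_x g (\bigcup_n F n) x =
    \int[lambda]_x (\sum_(n <oo) g (F n) x).
  apply: eq_integral => x _.
  have [/gP[P gE]|/g0 gE] := boolP (x \in ~` N).
    rewrite gE measure_semi_bigcup//.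
    by apply: eq_eseriesr => n _; rewrite gE.
  by rewrite gE eseries0.
rewrite integral_nneseries//; last by move=> n; exact: mg.
under eq_fun do (under eq_bigr do rewrite sigmaE//).
apply: is_cvg_ereal_nneg_natsum => n _.
by apply: integral_ge0.
Qed.

HB.instance Definition _ := isMeasure.Build _ _ _ sigma
  sigma0 sigma_ge0 sigma_sigma_additive.

End mixture.

Definition nu {R : realType} {d : measure_display} {X : measurableType d}
    {lambda : {measure set X -> \bar R}} (m : aekernel lambda) :
    {measure set X -> \bar R} :=
  measure_add (mscale (2^-1)%:nng%R (sigma m)) (mscale (2^-1)%:nng%R lambda).

Section risk.
Context {R : realType} {d : measure_display} {X : measurableType d}.

Definition risk (mu : probability (X * bool)%type R) (m : aekernel (rho mu))
    (Psi : R -> R) (A : set X) : \bar R :=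
  \int[rho_ mu false]_x (Psi (fine (m x A)))%:E +
  \int[rho_ mu true]_x (Psi (fine (m x (~` A))))%:E.

Definition Psi_ (p t : R) : R := Num.min (t / p)%R 1%R.

Definition Psi0 (t : R) : R := (if 0 < t then 1 else 0)%R.

Definition weakstar_cvg (lambda : {measure set X -> \bar R})
    (f_ : nat -> X -> R) (f : X -> R) : Prop :=
  forall phi : X -> R, phi \in Lfun lambda 1%E ->
    (\int[lambda]_x (phi x * f_ n x))%R @[n --> \oo] -->
    (\int[lambda]_x (phi x * f x))%R.

(* Gamma-convergence, as p -> 0, of functionals of measurable sets. *)
Definition Gamma_cvg (lambda : {measure set X -> \bar R})
    (F : R -> set X -> \bar R) (F0 : set X -> \bar R) : Prop :=
  forall p : nat -> R, (forall n, 0 < p n < 1)%R ->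
    p n @[n --> \oo] --> (0 : R)%R ->
    (forall (A_ : nat -> set X) (A : set X),
        (forall n, measurable (A_ n)) -> measurable A ->
        weakstar_cvg lambda (fun n => \1_(A_ n)) \1_A ->
        F0 A <= limn_einf (fun n => F (p n) (A_ n))) /\
    (forall A : set X, measurable A ->
        exists A_ : nat -> set X,
          [/\ forall n, measurable (A_ n),
              weakstar_cvg lambda (fun n => \1_(A_ n)) \1_A &
              limn_esup (fun n => F (p n) (A_ n)) <= F0 A]).

End risk.

(* Main.v *)
(** The limit being an indicator, testing weak-* convergence against the
    indicators of [A] and of its complement gives [lambda (A_n `+` A) --> 0],
    hence [sigma m (A_n `+` A) --> 0], for both [lambda = sigma m] and
    [lambda = nu m].  As [Psi_ q] is 1/q-Lipschitz and [Psi_ p] decreases in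
    [p], for [p <= q]
      [risk_q A <= risk_q A_n + sigma (A_n `+` A) / q
                <= risk_p A_n + sigma (A_n `+` A) / q],
    so [risk_q A] is below the limit inferior for every [q]; monotone
    convergence as [q --> 0] concludes.  The constant sequence is a recovery
    sequence because [Psi_ p <= Psi0]. *)
Require Import Defs.
From mathcomp Require Import all_boot all_order all_algebra.
From mathcomp Require Import all_classical all_reals all_analysis.
From mathcomp Require Import measurable_realfun lra.

Set Implicit Arguments.
Unset Strict Implicit.
Unset Printing Implicit Defensive.

Import Order.TTheory GRing.Theory Num.Theory.
Import numFieldNormedType.Exports.

Local Open Scope classical_set_scope.
Local Open Scope ring_scope.
Local Open Scope ereal_scope.

(** * Bounds for limits inferior and superior *)

Lemma limn_einf_ge (R : realType) (u : (\bar R)^nat) (l : \bar R) :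
  (\forall n \near \oo, l <= u n) -> l <= limn_einf u.
Proof.
move=> [N _ lu]; rewrite limn_einf_lim; apply: lime_ge.
  exact: is_cvg_einfs.
exists N => // n /= Nn; apply: le_ereal_inf_tmp => _ [k /= nk <-].
by apply: lu => /=; exact: leq_trans nk.
Qed.

Lemma limn_esup_le (R : realType) (u : (\bar R)^nat) (l : \bar R) :
  (forall n, u n <= l) -> limn_esup u <= l.
Proof.
move=> ul; rewrite -leeN2 -limn_einfN; apply: limn_einf_ge.
by apply: nearW => n /=; rewrite leeN2.
Qed.

(** Absorbs the error [sigma m (A_n]+[A) / q]. For each [e > 0], eventually [v n < e], so
    [l - e <= u n] from some rank on; then [e] is arbitrary. *)
Lemma limn_einf_ge_addr (R : realType) (u v : (\bar R)^nat) (l : \bar R) :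
  (\forall n \near \oo, l <= u n + v n) -> v @ \oo --> 0 ->
  l <= limn_einf u.
Proof.
move=> luv v0; apply/lee_addgt0Pr => e e0.
rewrite -leeBlDr//; apply: limn_einf_ge.
have ve : \forall n \near \oo, v n < e%:E.
  by apply: (v0 _ (open_ereal_lt' _)); rewrite lte_fin.
near=> n; rewrite leeBlDr//.
apply: (@le_trans _ _ (u n + v n)); first by near: n.
by apply: leeD2l; apply: ltW; near: n.
Unshelve. all: by end_near. Qed.

(** * The truncations [Psi_ p] as real functions *)

Section truncation.
Context {R : realType}.
Implicit Types p q t : R.

Lemma Psi__ge0 p t : (0 <= p -> 0 <= t -> 0 <= Psi_ p t)%R.
Proof. by move=> p0 t0; rewrite /Psi_ le_min ler01 divr_ge0. Qed.

Lemma Psi__le p q t : (0 < p -> p <= q -> 0 <= t -> Psi_ q t <= Psi_ p t)%R.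
Proof.
move=> p0 pq t0; rewrite /Psi_ le_min !ge_min lexx orbT andbT.
apply/orP; left; apply: ler_wpM2l => //; rewrite lef_pV2//.
by rewrite posrE (lt_le_trans p0).
Qed.

Lemma Psi__le_Psi0 p t : (0 <= t -> Psi_ p t <= Psi0 t)%R.
Proof.
rewrite le_eqVlt /Psi_ /Psi0 => /predU1P[<-|->].
  by rewrite ltxx mul0r ge_min lexx.
by rewrite ge_min lexx orbT.
Qed.

(** This one-sided form takes its hypothesis directly from subadditivity of a measure, with no
    absolute values. *)
Lemma Psi__lipschitz q (a b c : R) : (0 < q -> 0 <= c -> a <= b + c ->
  Psi_ q a <= Psi_ q b + q^-1 * c)%R.
Proof.
move=> q0 c0 abc; have qc0 : (0 <= q^-1 * c)%R.
  by rewrite mulr_ge0// invr_ge0 ltW.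
have : (a / q <= b / q + q^-1 * c)%R.
  by rewrite (mulrC _ c) -mulrDl ler_pM2r// invr_gt0.
(* In each branch of the two minima the claim is linear in [a / q], [b / q] and [q^-1 * c];
   nonnegativity of the last settles those where the right minimum is 1. *)
by rewrite /Psi_ /Num.min; case: ifPn; case: ifPn; rewrite -?leNgt; lra.
Qed.

Lemma measurable_Psi_ p : measurable_fun [set: R] (Psi_ p).
Proof. by apply: measurable_minr => //; exact: mulrr_measurable. Qed.

Lemma measurable_Psi0 : measurable_fun [set: R] (@Psi0 R).
Proof. by apply: measurable_fun_ifT => //; exact: measurable_fun_ltr. Qed.

Lemma cvg_Psi_ t : (0 <= t)%R ->
  Psi_ (n.+1%:R^-1) t @[n --> \oo] --> Psi0 t.
Proof.
rewrite le_eqVlt => /predU1P[<-|t0].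
  rewrite /Psi0 ltxx; apply: cvg_near_cst; apply: nearW => n.
  by rewrite /Psi_ mul0r minEle ler01.
rewrite /Psi0 t0; apply: cvg_near_cst.
(* From this rank on [n.+1 > t^-1], so [t * n.+1] exceeds 1 and the truncated value is exactly 1. *)
exists (Num.truncn (t^-1)) => // n /= tn; rewrite /Psi_ invrK minEle.
case: ifPn => // tn1; apply: le_anti.
rewrite tn1/= -ler_pdivrMl// mulr1; apply/ltW.
apply: lt_le_trans (truncnS_gt _) _.
by rewrite ler_nat.
Qed.

End truncation.

(** * Weak-* convergence to an indicator *)

Section weakstar.
Context {R : realType} {d : measure_display} {X : measurableType d}.
Variable lambda : {measure set X -> \bar R}.
Hypothesis lambda_fin : lambda setT < +oo.

Let fin B : measurable B -> lambda B \is a fin_num.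
Proof.
move=> mB; rewrite ge0_fin_numE//; apply: le_lt_trans lambda_fin.
by apply: le_measure; rewrite ?inE.
Qed.

Lemma indic_Lfun1 B : measurable B -> \1_B \in Lfun lambda 1.
Proof.
move=> mB; apply/Lfun1_integrable/integrableP; split.
  exact/measurable_EFinP.
under eq_integral do rewrite /= ger0_norm//.
by rewrite integral_indic// setIT ltey_eq fin.
Qed.

Lemma Rintegral_indicM C B : measurable C -> measurable B ->
  (\int[lambda]_x (\1_C x * \1_B x))%R = fine (lambda (C `&` B)).
Proof.
move=> mC mB; rewrite /Rintegral; congr fine.
rewrite -[C `&` B]setIT -integral_indic//; last exact: measurableI.
by apply: eq_integral => x _; rewrite indicI.
Qed.

Lemma weakstar_cvg_setY (A_ : nat -> set X) (A : set X) :
  (forall n, measurable (A_ n)) -> measurable A ->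
  weakstar_cvg lambda (fun n => \1_(A_ n)) \1_A ->
  lambda (A_ n `+` A) @[n --> \oo] --> 0.
Proof.
move=> mA_ mA cA; have mAc := measurableC mA.
have := cA _ (indic_Lfun1 mA); have := cA _ (indic_Lfun1 mAc).
under eq_fun do rewrite Rintegral_indicM//.
rewrite Rintegral_indicM// setICl measure0/= => c1.
under eq_fun do rewrite Rintegral_indicM//.
rewrite Rintegral_indicM// setIid => c2.
(* The first term is the mass of [A_ n] outside [A]. The difference is the mass of [A] outside
   [A_ n], a real subtraction because [lambda] is finite. *)
have -> : (fun n => lambda (A_ n `+` A)) = (fun n =>
    (fine (lambda (~` A `&` A_ n)) +
     (fine (lambda A) - fine (lambda (A `&` A_ n))))%:E).
  apply/funext => n; have mAn := mA_ n.
  rewrite measureU; [|exact: measurableD|exact: measurableD|]; last first.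
    by apply/seteqP; split => x //= [[? ?] []].
  rewrite EFinD EFinB !fineK ?fin//; try exact: measurableI.
  by rewrite [X in _ + X = _]measureD ?ltey_eq ?fin// setDE setIC.
apply: cvg_EFin; first exact: nearW.
rewrite -[0%R]addr0 -[X in (_ + X)%R](subrr (fine (lambda A))).
apply: cvgD => //; apply: cvgB => //; exact: cvg_cst.
Qed.

End weakstar.

(* Replacing [m] by genuine measures on a null set makes pointwise
   inequalities between the integrands available at every point. *)
Lemma aekernel_version (R : realType) (d : measure_display)
    (X : measurableType d) (lambda : {measure set X -> \bar R})
    (m : aekernel lambda) :
  exists K : X -> {measure set X -> \bar R},
    [/\ forall x, K x setT <= 1,
        forall B, measurable B -> measurable_fun setT (K ^~ B) &
        {ae lambda, forall x, m x = K x :> (set X -> \bar R)}].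
Proof.
have [N [mN N0 Nm]] := aekernel_prob m.
(* With the zero measure on [N], [K ^~ B] is the restriction of [m] to the complement of [N], hence
   measurable; total mass is then only bounded by 1. *)
have /choice[K KP] : forall x, exists k : {measure set X -> \bar R},
    [/\ ~ N x -> m x = k :> (set X -> \bar R), N x -> k = mzero &
        k setT <= 1].
  move=> x; have [Nx|nNx] := pselect (N x).
    by exists mzero; split => //; rewrite /mzero lee01.
  have /contrapT[P mP] : ~ ~ exists P : probability X R,
      m x = P :> (set X -> \bar R) by move=> /Nm.
  by exists P; split => //; exact: probability_le1.
exists K; split.
- by move=> x; have [] := KP x.
- move=> B mB.
  have -> : K ^~ B = (fun x => m x B) \_ (~` N).
    apply/funext => x; rewrite patchE; have [mK K0 _] := KP x.
    have [Nx|nNx] := pselect (N x); first by rewrite (K0 Nx) memNset.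
    by rewrite mK// mem_set.
  apply/(measurable_restrictT _ _).1; first exact: measurableC.
  by apply: measurable_funS (aekernel_measurable m mB).
- exists N; split => // x /=; apply: contra_notP => nNx.
  by have [+ _ _] := KP x; apply.
Qed.

(** * Estimates for the risk and Gamma-convergence *)

Section risk.
Context {R : realType} {d : measure_display} {X : measurableType d}.
Variables (mu : probability (X * bool)%type R) (m : aekernel (rho mu)).

Let rhoE B : rho mu B = rho_ mu false B + rho_ mu true B.
Proof. exact: measure_addE. Qed.

(** Each [rho_ mu i] is dominated by the sum [rho mu], so null sets are inherited. *)
Lemma ae_rho_ (i : bool) (P : X -> Prop) :
  {ae rho mu, forall x, P x} -> {ae rho_ mu i, forall x, P x}.
Proof.
move=> [N [mN]]; rewrite rhoE => /eqP.
rewrite padde_eq0 ?measure_ge0// => /andP[/eqP N0 /eqP N1] PN.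
by exists N; split => //; case: i.
Qed.

Lemma rho_fin : rho mu setT < +oo.
Proof.
have fin i : rho_ mu i setT < +oo.
  rewrite /rho_; apply: (@le_lt_trans _ _ 1); last exact: ltry.
  by apply: probability_le1; exact: measurableX.
by rewrite rhoE; apply: lte_add_pinfty.
Qed.

Section version.
Variable K : X -> {measure set X -> \bar R}.
Hypothesis K_le1 : forall x, K x setT <= 1.
Hypothesis mK : forall B, measurable B -> measurable_fun setT (K ^~ B).
Hypothesis mE : {ae rho mu, forall x, m x = K x :> (set X -> \bar R)}.

Let K_fin x B : measurable B -> K x B \is a fin_num.
Proof.
move=> mB; rewrite ge0_fin_numE//; apply: le_lt_trans (ltry 1).
by apply: le_trans (K_le1 x); apply: le_measure; rewrite ?inE.
Qed.

Let fine_K_ge0 x B : (0 <= fine (K x B))%R.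
Proof. exact/fine_ge0/measure_ge0. Qed.

Let measurable_Psi_K (Psi : R -> R) B : measurable_fun setT Psi ->
  measurable B -> measurable_fun setT (fun x => (Psi (fine (K x B)))%:E).
Proof.
move=> mPsi mB; apply/measurable_EFinP; apply: measurableT_comp => //.
by apply: measurableT_comp (mK mB).
Qed.

Lemma sigma_version B : measurable B -> sigma m B = \int[rho mu]_x K x B.
Proof.
move=> mB; apply: ae_eq_integral => //.
- exact: aekernel_measurable.
- exact: mK.
- by apply: filterS mE => x mKx _; rewrite mKx.
Qed.

Lemma risk_version (Psi : R -> R) A :
  measurable_fun setT Psi -> measurable A ->
  risk m Psi A = \int[rho_ mu false]_x (Psi (fine (K x A)))%:E +
                 \int[rho_ mu true]_x (Psi (fine (K x (~` A))))%:E.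
Proof.
move=> mPsi mA.
have E i B : measurable B -> \int[rho_ mu i]_x (Psi (fine (m x B)))%:E =
    \int[rho_ mu i]_x (Psi (fine (K x B)))%:E.
  move=> mB; apply: ae_eq_integral => //.
  - apply/measurable_EFinP; apply: measurableT_comp => //.
    by apply: measurableT_comp (aekernel_measurable m mB).
  - exact: measurable_Psi_K.
  - by apply: ae_rho_; apply: filterS mE => x mKx _; rewrite mKx.
by rewrite /risk !E//; exact: measurableC.
Qed.

Lemma sigmaT_fin_version : sigma m setT < +oo.
Proof.
rewrite sigma_version//.
apply: (@le_lt_trans _ _ (\int[rho mu]_x 1)); last first.
  by rewrite integral_cst// mul1e rho_fin.
by apply: ge0_le_integral => //; exact: mK.
Qed.

Lemma risk_le_version (Psi Psi' : R -> R) A :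
  measurable_fun setT Psi -> measurable_fun setT Psi' ->
  (forall t, (0 <= t)%R -> (0 <= Psi t <= Psi' t)%R) ->
  measurable A -> risk m Psi A <= risk m Psi' A.
Proof.
move=> mPsi mPsi' PsiPsi' mA; have mAc := measurableC mA.
rewrite !risk_version//; apply: leeD; apply: ge0_le_integral => //;
  try exact: measurable_Psi_K.
- by move=> x _; rewrite lee_fin; have /andP[] := PsiPsi' _ (fine_K_ge0 x A).
- by move=> x _; rewrite lee_fin; have /andP[] := PsiPsi' _ (fine_K_ge0 x A).
- move=> x _; rewrite lee_fin.
  by have /andP[] := PsiPsi' _ (fine_K_ge0 x (~` A)).
- move=> x _; rewrite lee_fin.
  by have /andP[] := PsiPsi' _ (fine_K_ge0 x (~` A)).
Qed.

(** The same set [D] controls the passage from [B] to [A] and from [~] B[to]~[A]. The errors under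
    the two label marginals therefore add up to an integral against [rho mu], which is
    [sigma m D]. *)
Lemma risk_Psi__lipschitz_version q A B : (0 < q)%R ->
  measurable A -> measurable B ->
  risk m (Psi_ q) A <= risk m (Psi_ q) B + q^-1%:E * sigma m (B `+` A).
Proof.
move=> q0 mA mB; set D := B `+` A.
have q0' := ltW q0.
have mPsi := @measurable_Psi_ R q.
have mD : measurable D by apply: measurableU; exact: measurableD.
have le_int i E F : measurable E -> measurable F -> E `<=` F `|` D ->
    \int[rho_ mu i]_x (Psi_ q (fine (K x E)))%:E <=
    \int[rho_ mu i]_x (Psi_ q (fine (K x F)))%:E +
    q^-1%:E * \int[rho_ mu i]_x K x D.
  move=> mE' mF EFD.
  have qK_ge0 x : 0 <= q^-1%:E * K x D.
    by rewrite mule_ge0// lee_fin invr_ge0.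
  have mqK : measurable_fun setT (fun x => q^-1%:E * K x D).
    by apply: measurable_funeM; exact: mK.
  rewrite -ge0_integralZl//; last 2 first.
  - exact: mK.
  - by rewrite lee_fin invr_ge0.
  rewrite -ge0_integralD//; last 2 first.
  - by move=> x _; rewrite lee_fin Psi__ge0.
  - exact: measurable_Psi_K.
  apply: ge0_le_integral => //.
  - by move=> x _; rewrite lee_fin Psi__ge0.
  - exact: measurable_Psi_K.
  - by apply: emeasurable_funD => //; exact: measurable_Psi_K.
  (* Pointwise, subadditivity gives [K x E <= K x F + K x D], the hypothesis of [Psi__lipschitz]. *)
  - move=> x _; rewrite -[K x D]fineK ?K_fin// -EFinM -EFinD lee_fin.
    apply: Psi__lipschitz => //.
    rewrite -lee_fin EFinD !fineK ?K_fin//.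
    apply: (@le_trans _ _ (K x (F `|` D))); last exact: measureU2.
    by apply: le_measure => //; rewrite inE//; exact: measurableU.
rewrite !risk_version// sigma_version//.
rewrite ge0_integral_measure_add//; last exact: mK.
rewrite ge0_muleDr; try exact: integral_ge0.
rewrite [leRHS]addeACA; apply: leeD; apply: le_int => //; try exact: measurableC.
- by move=> x Ax; have [Bx|Bx] := pselect (B x); [left|right; right].
- by move=> x Ax; have [Bx|Bx] := pselect (B x); [right; left|left].
Qed.

(** As [n] grows the integrands increase to [Psi0], so monotone convergence applies under each
    marginal. *)
Lemma cvg_risk_Psi__version A : measurable A ->
  risk m (Psi_ n.+1%:R^-1) A @[n --> \oo] --> risk m (@Psi0 R) A.
Proof.
move=> mA; have mAc := measurableC mA.
have cvg_int i B : measurable B ->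
    \int[rho_ mu i]_x (Psi_ n.+1%:R^-1 (fine (K x B)))%:E @[n --> \oo] -->
    \int[rho_ mu i]_x (Psi0 (fine (K x B)))%:E.
  move=> mB.
  have -> : \int[rho_ mu i]_x (Psi0 (fine (K x B)))%:E =
      \int[rho_ mu i]_x limn (fun n => (Psi_ n.+1%:R^-1 (fine (K x B)))%:E).
    apply: eq_integral => x _; apply/esym/cvg_lim => //.
    by apply: cvg_EFin; [exact: nearW|exact: cvg_Psi_].
  apply: cvg_monotone_convergence => //.
  - by move=> n; apply: measurable_Psi_K => //; exact: measurable_Psi_.
  - by move=> n x _; rewrite lee_fin Psi__ge0.
  - move=> x _ j k jk; rewrite lee_fin; apply: Psi__le => //.
    by rewrite lef_pV2 ?posrE// ler_nat.
rewrite risk_version//; last exact: measurable_Psi0.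
under eq_fun do rewrite (risk_version (measurable_Psi_ _) mA).
apply: cvgeD; [|exact: cvg_int|exact: cvg_int].
apply: ge0_adde_def; rewrite inE; apply: integral_ge0 => x _;
  by rewrite lee_fin /Psi0; case: ifP.
Qed.

End version.

Lemma sigmaT_fin : sigma m setT < +oo.
Proof.
by have [K [K1 mK mE]] := aekernel_version m; exact: sigmaT_fin_version mE.
Qed.

Lemma risk_le (Psi Psi' : R -> R) A :
  measurable_fun setT Psi -> measurable_fun setT Psi' ->
  (forall t, (0 <= t)%R -> (0 <= Psi t <= Psi' t)%R) ->
  measurable A -> risk m Psi A <= risk m Psi' A.
Proof.
by have [K [K1 mK mE]] := aekernel_version m; exact: (risk_le_version mK mE).
Qed.

Lemma risk_Psi__lipschitz q A B : (0 < q)%R ->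
  measurable A -> measurable B ->
  risk m (Psi_ q) A <= risk m (Psi_ q) B + q^-1%:E * sigma m (B `+` A).
Proof.
have [K [K1 mK mE]] := aekernel_version m.
exact: (risk_Psi__lipschitz_version K1 mK mE).
Qed.

Lemma cvg_risk_Psi_ A : measurable A ->
  risk m (Psi_ n.+1%:R^-1) A @[n --> \oo] --> risk m (@Psi0 R) A.
Proof.
have [K [K1 mK mE]] := aekernel_version m.
exact: (cvg_risk_Psi__version mK mE).
Qed.

(** The topology enters only through the domination of [sigma m] by [lambda], which turns
    [lambda]-small symmetric differences into [sigma m]-small ones. Both topologies are thus
    instances. *)
Lemma Gamma_cvg_risk (lambda : {measure set X -> \bar R}) (c : R) :
  lambda setT < +oo -> (0 <= c)%R ->
  (forall B, measurable B -> sigma m B <= c%:E * lambda B) ->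
  Gamma_cvg lambda (fun p => risk m (Psi_ p)) (risk m (@Psi0 R)).
Proof.
move=> lambda_fin c0 sigma_le p p01 p_cvg0; split.
  move=> A_ A mA_ mA /(weakstar_cvg_setY lambda_fin mA_ mA) lambda0.
  have sigma0 : sigma m (A_ n `+` A) @[n --> \oo] --> 0.
    apply: (@squeeze_cvge _ _ _ _ (cst 0) _
        (fun n => c%:E * lambda (A_ n `+` A))).
    - apply: nearW => n; rewrite measure_ge0 /=; apply: sigma_le.
      by apply: measurableU; exact: measurableD.
    - exact: cvg_cst.
    - by rewrite -[X in _ --> X](mule0 c%:E); apply: cvgeZl.
  (* The limit inferior does not depend on [k], so it suffices to bound it below for each fixed
     [q = 1/(k+1)], letting [n] tend to infinity before [k]. *)
  apply: (cvge_to_le (cvg_risk_Psi_ mA)); apply: nearW => k.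
  set q := (k.+1%:R^-1)%R; have q0 : (0 < q :> R)%R by rewrite invr_gt0.
  apply: (@limn_einf_ge_addr _ _ (fun n => q^-1%:E * sigma m (A_ n `+` A))).
    have pq : \forall n \near \oo, (p n <= q)%R.
      by apply: (cvgr_le _ p_cvg0); exact: q0.
    apply: filterS pq => n pq.
    apply: le_trans (risk_Psi__lipschitz q0 mA (mA_ n)) _.
    apply: leeD2r; have /andP[p0 _] := p01 n.
    apply: risk_le => //; try exact: measurable_Psi_.
    by move=> t t0; rewrite Psi__ge0 ?(ltW q0)// Psi__le.
  by rewrite -[X in _ --> X](mule0 q^-1%:E); apply: cvgeZl.
move=> A mA; exists (fun=> A); split => //.
  by move=> phi _; exact: cvg_cst.
apply: limn_esup_le => n; have /andP[p0 _] := p01 n.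
apply: risk_le => //; [exact: measurable_Psi_|exact: measurable_Psi0|].
by move=> t t0; rewrite Psi__ge0 ?(ltW p0)// Psi__le_Psi0.
Qed.

End risk.

Theorem proposition9 (R : realType) (d : measure_display)
    (X : measurableType d) (mu : probability (X * bool)%type R)
    (m : aekernel (rho mu)) :
  Gamma_cvg (sigma m) (fun p => risk m (Psi_ p)) (risk m (@Psi0 R)) /\
  Gamma_cvg (nu m) (fun p => risk m (Psi_ p)) (risk m (@Psi0 R)).
Proof.
have sigma_fin := sigmaT_fin m; split.
  apply: (@Gamma_cvg_risk _ _ _ _ _ _ 1) => // B mB.
  by rewrite mul1e.
have nuE B : nu m B = 2^-1%:E * sigma m B + 2^-1%:E * rho mu B.
  exact: measure_addE.
(* The constant 2 undoes the weight 1/2 of [sigma m] in [nu m]: twice [nu m B] is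
   [sigma m B + rho mu B]. *)
apply: (@Gamma_cvg_risk _ _ _ _ _ _ 2) => // [|B mB]; rewrite nuE.
  by apply: lte_add_pinfty; apply: lte_mul_pinfty => //; exact: rho_fin.
rewrite muleDr ?ge0_adde_def// ?inE ?mule_ge0// !muleA -EFinM divff// !mul1e.
by rewrite leeDl.
Qed.
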